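(* Let $X$, $Y$, $Z$ be Banach spaces and let $G\in L(X,Y)$. If $G$ has the alternative Daugavet property and $T\in L(X,Z)$ satisfies that $T(B_{X_0})$ is an SCD set for every separable subspace $X_0$ of $X$, then $T$ is a target for $G$. Therefore, if $Z=Y$ then $\sup_{\omega\in\mathbb{T}}\|G+\omega T\|=1+\|T\|$.
   Context: Scalars are $\mathbb{K}=\mathbb{R}$ or $\mathbb{C}$; $\mathbb{T}=\{\omega\in\mathbb{K}:|\omega|=1\}$; subspaces are closed; $B_X$, $S_X$ are the closed unit ball and unit sphere; $\operatorname{aconv}(F)=\operatorname{conv}(\mathbb{T}F)$. $G\in L(X,Y)$ has the alternative Daugavet property if $\sup_{\omega\in\mathbb{T}}\|G+\omega T\|=1+\|T\|$ for every rank-one $T\in L(X,Y)$ (including $T=0$, so $\|G\|=1$). Target: given a norm-one $G\in L(X,Y)$, an operator $T\in L(X,Z)$ is a target for $G$ if for every $x_0\in B_X$, $\varepsilon>0$ and $y\in S_Y$ there is $F\subset B_X$ such that $\operatorname{conv}(F)\subset\{x\in B_X:\|Gx+y\|>2-\varepsilon\}$ and $\operatorname{dist}(Tx_0,T(\operatorname{aconv}(F)))<\varepsilon$. A slice of a bounded set $A\subset Z$ is a set $\{z\in A:\operatorname{Re}z^*(z)>\sup_A\operatorname{Re}z^*-\alpha\}$ with $z^*\in Z^*$, $\alpha>0$. A bounded set $A\subset Z$ is slicely countably determined (SCD) if there is a countable family $\{S_n:n\in\mathbb{N}\}$ of slices of $A$ such that $A\subset\overline{\operatorname{conv}}(B)$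 whenever $B\cap S_n\neq\emptyset$ for every $n\in\mathbb{N}$. *)

(* Defs.v *)
From HB Require Import structures.
From mathcomp Require Import all_boot all_order all_algebra.
From mathcomp Require Import all_classical all_reals all_analysis.
From mathcomp Require Import complex.

Set Implicit Arguments.
Unset Strict Implicit.
Unset Printing Implicit Defensive.

Import Order.TTheory GRing.Theory Num.Theory.
Import numFieldNormedType.Exports.

Local Open Scope classical_set_scope.
Local Open Scope ring_scope.

Inductive scalar_kind := RealScalars | ComplexScalars.

Definition scalar_field (R : realType) (k : scalar_kind) : numFieldType :=
  match k with
  | RealScalars => R
  | ComplexScalars => (R[i])%C
  end.

Definition re_part {R : realType} {k : scalar_kind} : scalar_field R k -> R :=
  match k with
  | RealScalars => fun a => a
  | ComplexScalars => fun a => complex.Re a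
  end.

(* The library norm of a module over K takes its values in K itself; its values
   are real, so for K = R[i] nothing is lost by projecting them to R. *)
Definition rnorm {R : realType} {k : scalar_kind}
  {X : normedModType (scalar_field R k)} (x : X) : R := re_part `|x|.

Section BanachGeometry.
Context {R : realType} {k : scalar_kind}.
Local Notation K := (scalar_field R k).
Implicit Types X Y Z : normedModType K.

Definition unit_scalars : set K := [set w | `|w| = 1].

Definition unit_ball X : set X := [set x | rnorm x <= 1].

Definition unit_sphere X : set X := [set x | rnorm x = 1].

Definition conv_hull X (A : set X) : set X := smallest (@convex_set K X) A.

Definition aconv X (F : set X) : set X :=
  conv_hull [set w *: x | w in unit_scalars & x in F].

(* Extended-real infimum, so that the distance to the empty set is +oo. *)
Definition dist_to X (x : X) (A : set X) : \bar R :=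
  ereal_inf [set (rnorm (x - a))%:E | a in A].

Definition opnorm X Y (T : X -> Y) : R :=
  sup [set rnorm (T x) | x in @unit_ball X].

Definition rank_at_most_one X Y (T : X -> Y) : Prop :=
  exists y : Y, forall x, exists c : K, T x = c *: y.

(* The zero operator is among the test operators, so that opnorm G = 1. *)
Definition alternative_Daugavet X Y (G : X -> Y) : Prop :=
  forall T : {linear X -> Y}, continuous T -> rank_at_most_one T ->
    sup [set opnorm (G \+ w \*: T) | w in unit_scalars] = 1 + opnorm T.

(* Targets are only defined for norm-one G. *)
Definition is_target X Y Z (G : X -> Y) (T : X -> Z) : Prop :=
  opnorm G = 1 /\
  forall (x0 : X) (eps : R) (y : Y),
    unit_ball x0 -> 0 < eps -> unit_sphere y ->
    exists F : set X,
      [/\ F `<=` @unit_ball X,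
          conv_hull F `<=` [set x | unit_ball x /\ 2 - eps < rnorm (G x + y)]
        & (dist_to (T x0) (T @` aconv F) < eps%:E)%E].

Definition is_slice Z (A S : set Z) : Prop :=
  exists (f : {linear Z -> K^o}) (alpha : R),
    [/\ continuous f, 0 < alpha
      & S = [set z | A z /\ sup [set re_part (f a) | a in A] - alpha < re_part (f z)]].

Definition is_SCD Z (A : set Z) : Prop :=
  bounded_set A /\
  exists S : nat -> set Z,
    (forall n, is_slice A (S n)) /\
    (forall B : set Z, (forall n, B `&` S n !=set0) ->
      A `<=` closure (conv_hull B)).

Definition is_closed_subspace X (X0 : set X) : Prop :=
  [/\ closed X0, X0 0, (forall x y, X0 x -> X0 y -> X0 (x + y))
    & forall (a : K) x, X0 x -> X0 (a *: x)].

Definition is_separable X (X0 : set X) : Prop :=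
  exists D : set X, [/\ countable D, D `<=` X0 & X0 `<=` closure D].

Definition SCD_on_separable_subspaces X Z (T : X -> Z) : Prop :=
  forall X0 : set X, is_closed_subspace X0 -> is_separable X0 ->
    is_SCD (T @` (X0 `&` @unit_ball X)).

End BanachGeometry.

(* Main.v *)
(* With W(z) the set of u in the unit ball with |G u + z| > 1 + |z| - e, testing the alternative
   Daugavet property on rank-one operators f (x) z and separating with Hahn-Banach shows that
   every point of the unit ball of X is a limit of absolutely convex combinations of points of
   W(z). Closing {x0} under countably many operations gives a separable subspace X0 containing
   x0 in which this still holds for z = y + G v with v in X0, so every slice of T(B_X0) contains
   the image of some rotation of a point of W(z) in X0. Running through the slices S_n that
   witness the SCD property, choose u_n in X0 with a rotation of T u_n in S_n and
   |y + G u_0 + ... + G u_n| almost n + 2. Norm sums this large force |G x + y| > 2 - e for each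
   x in conv {u_n}, while T x0 is in the closure of T (aconv {u_n}).
   The norm equality holds for any target T : X -> Y, because c |-> |G x + T c| can be controlled
   along the convex combinations x of the u_i and c of the w_i u_i with the same coefficients. *)
Require Import Defs.
From HB Require Import structures.
From mathcomp Require Import all_boot all_order all_algebra.
From mathcomp Require Import all_classical all_reals all_analysis.
From mathcomp Require Import complex ring lra.
Set Implicit Arguments.
Unset Strict Implicit.
Unset Printing Implicit Defensive.
Import Order.TTheory GRing.Theory Num.Theory.
Import numFieldNormedType.Exports.
Local Open Scope classical_set_scope.
Local Open Scope ring_scope.

(** * Real and complex scalars handled uniformly through [of_real] and [re_part] *)

Section Scalars.
Context {R : realType} {k : scalar_kind}.
Local Notation K := (scalar_field R k).

Definition of_real : R -> K :=
  match k with
  | RealScalars => fun r => r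
  | ComplexScalars => fun r => (r%:C)%C
  end.

Lemma of_real_is_zmod_morphism : zmod_morphism of_real.
Proof. by rewrite /of_real; case: k => // x y; rewrite rmorphB. Qed.

Lemma of_real_is_monoid_morphism : monoid_morphism of_real.
Proof. by rewrite /of_real; case: k; split => // x y; rewrite rmorphM. Qed.

HB.instance Definition _ :=
  GRing.isZmodMorphism.Build R K of_real of_real_is_zmod_morphism.
HB.instance Definition _ :=
  GRing.isMonoidMorphism.Build R K of_real of_real_is_monoid_morphism.

Lemma re_part_is_zmod_morphism : zmod_morphism (@re_part R k).
Proof. by rewrite /re_part; case: k => // -[a b] [c d]. Qed.

HB.instance Definition _ :=
  GRing.isZmodMorphism.Build K R (@re_part R k) re_part_is_zmod_morphism.

Lemma of_realK : cancel of_real (@re_part R k).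
Proof. by rewrite /of_real /re_part; case: k => r. Qed.

Lemma re_partM r (a : K) : re_part (of_real r * a) = r * re_part a.
Proof.
by move: a; rewrite /of_real /re_part; case: k => // -[a b] /=; rewrite mul0r subr0.
Qed.

Lemma ler_of_real r s : (of_real r <= of_real s) = (r <= s).
Proof. by rewrite /of_real; case: k => //; rewrite lecR. Qed.

Lemma ger0_of_real (a : K) : 0 <= a -> of_real (re_part a) = a.
Proof.
move: a; rewrite /of_real /re_part; case: k => // -[a b].
by rewrite lecE /= => /andP[/eqP-> _].
Qed.

Lemma re_part_le_norm (a : K) : re_part a <= re_part `|a|.
Proof.
move: a; rewrite /re_part; case: k => [a|a]; first exact: ler_norm.
by have /(le_trans (ler_norm _)) : `|complex.Re a| <= complex.Re `|a|;
  [have := normc_ge_Re a; rewrite lecE => /andP[]|].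
Qed.

Lemma ex_phase (a : K) : exists2 w : K, `|w| = 1 & w * a = `|a|.
Proof.
have [->|a0] := eqVneq a 0; first by exists 1; rewrite ?normr1 ?mulr0 ?normr0.
exists (`|a| / a); last by rewrite divfK.
by rewrite normrM normfV normr_id divff// normr_eq0.
Qed.

(* For complex scalars the functional is f x - i f(i x). *)
Lemma complexify (V : lmodType K) (f : V -> R) :
  zmod_morphism f -> (forall r x, f (of_real r *: x) = r * f x) ->
  exists g : {linear V -> K^o}, forall x, re_part (g x) = f x.
Proof.
move: V f; rewrite /of_real /re_part; case: k => V f fD fZ.
  have lf : linear (f : V -> R^o).
    move=> a x y; have f0 : f 0 = 0 by rewrite -(subrr 0) fD subrr.
    by rewrite -[y in LHS]opprK fD -[- y]sub0r fD f0 sub0r opprK fZ.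
  pose mf := GRing.isLinear.Build R V R^o *:%R (f : V -> R^o) lf.
  by exists (HB.pack_for {linear V -> R^o} (f : V -> R^o) mf).
have f0 : f 0 = 0 by rewrite -(subrr 0) fD subrr.
have fN x : f (- x) = - f x by rewrite -[- x]sub0r fD f0 sub0r.
have fA x y : f (x + y) = f x + f y by rewrite -[y in LHS]opprK fD fN opprK.
pose h x : R[i]%C^o := (f x -i* f ('i *: x))%C.
have lh : linear h.
  move=> -[a b] x y.
  have E v : (a +i* b)%C *: v = (a%:C)%C *: v + (b%:C)%C *: ('i%C *: v).
    by rewrite scalerA -scalerDl; congr (_ *: _); simpc.
  have E' : 'i%C *: ((a +i* b)%C *: x) = (a%:C)%C *: ('i%C *: x) - (b%:C)%C *: x.
    rewrite !scalerA -scaleNr -scalerDl; congr (_ *: _); simpc.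
    by congr (_ +i* _)%C.
  rewrite /h scalerDr E' E !fA fN !fZ.
  apply/eqP; rewrite eq_complex /=; apply/andP; split; apply/eqP; ring.
pose mh := GRing.isLinear.Build _ V R[i]%C^o *:%R h lh.
by exists (HB.pack_for {linear V -> R[i]%C^o} h mh).
Qed.

(** Rational or Gaussian rational scalars are enumerated by [unpickle]. Closing a countable set
    under these multiples is enough for its closure to absorb all scalars. *)
Lemma ex_dense_scalars :
  exists q : nat -> K, forall a (e : R), 0 < e -> exists n, re_part `|a - q n| < e.
Proof.
pose q0 n : rat := odflt 0 (unpickle n).
have q0P (r : R) e : 0 < e -> exists n, `|r - ratr (q0 n)| < e.
  move=> e0; have : r - e < r + e by lra.
  case/rat_in_itvoo => q; rewrite in_itv /= => /andP[h1 h2].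
  by exists (pickle q); rewrite /q0 pickleK /= ltr_norml; apply/andP; split; lra.
rewrite /re_part; case: k.
  by exists (fun n => ratr (q0 n)).
exists (fun n => let p := odflt (0, 0)%N (unpickle n) in
  (ratr (q0 p.1) +i* ratr (q0 p.2))%C) => -[a b] e e0.
have e2 : 0 < e / 2 by lra.
have [m hm] := q0P a _ e2; have [n hn] := q0P b _ e2.
exists (pickle (m, n)); rewrite pickleK /=.
set c := ratr _ in hm *; set d := ratr _ in hn *.
rewrite [ltLHS](congr1 (@complex.Re R) (normc_def ((a - c) +i* (b - d))%C)) /=.
apply: (@le_lt_trans _ _ (`|a - c| + `|b - d|)); last by lra.
rewrite -[leRHS]ger0_norm ?addr_ge0// -[leRHS]sqrtr_sqr ler_wsqrtr// [leRHS]sqrrD.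
rewrite !real_normK ?num_real//.
by rewrite lerD2r lerDl mulrn_wge0 // mulr_ge0.
Qed.

(* Restated so that the coercion of rmorphisms does not appear in goals. *)
Lemma of_real0 : of_real 0 = 0. Proof. exact: rmorph0. Qed.
Lemma of_real1 : of_real 1 = 1. Proof. exact: rmorph1. Qed.
Lemma of_realN r : of_real (- r) = - of_real r. Proof. exact: rmorphN. Qed.
Lemma of_realD r s : of_real (r + s) = of_real r + of_real s. Proof. exact: rmorphD. Qed.
Lemma of_realB r s : of_real (r - s) = of_real r - of_real s. Proof. exact: rmorphB. Qed.
Lemma of_realM r s : of_real (r * s) = of_real r * of_real s. Proof. exact: rmorphM. Qed.

End Scalars.

(** * A real Hahn-Banach theorem, proved through minimal sublinear functionals *)

Section HahnBanach.
Context {R : realType} {K : nzRingType} (emb : {rmorphism R -> K}) {V : lmodType K}.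
Implicit Types (p q : V -> R) (x y : V) (r : R).

(** The embedding [emb] makes [V] a real space without changing its module structure. Homogeneity is
    only an inequality, which is easier to check; [sublinearZ] recovers equality by rescaling with
    [r^-1]. *)
Definition sublinear p :=
  (forall x y, p (x + y) <= p x + p y) /\
  (forall r x, 0 <= r -> p (emb r *: x) <= r * p x).

Lemma sublinear_ge0 p x : sublinear p -> 0 <= p x + p (- x).
Proof.
move=> [pD pZ]; have p0 : 0 <= p 0 by have := pD 0 0; rewrite addr0; lra.
by apply: (le_trans p0); rewrite -(subrr x) pD.
Qed.

Lemma sublinearZ p r x : sublinear p -> 0 <= r -> p (emb r *: x) = r * p x.
Proof.
move=> sp r0; have [pD pZ] := sp; apply/eqP; rewrite eq_le pZ //=.
have [->|rn0] := eqVneq r 0.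
  rewrite rmorph0 scale0r mul0r.
  by have := pD 0 0; rewrite addr0; lra.
have r_gt0 : 0 < r by rewrite lt0r rn0.
have := pZ r^-1 (emb r *: x); rewrite scalerA -rmorphM mulVf // rmorph1 scale1r.
by rewrite invr_ge0 => /(_ r0); rewrite ler_pdivlMl.
Qed.

(** The index [l] may depend on the vectors, so the criterion covers chains in Zorn's lemma, tilted
    functionals and gauges alike. *)
Lemma sublinear_inf (I : Type) (A : set I) (s : I -> V -> R) :
    A !=set0 -> (forall x, has_lbound [set s i x | i in A]) ->
    (forall i j x y, A i -> A j -> exists2 l, A l & s l (x + y) <= s i x + s j y) ->
    (forall i r x, 0 <= r -> A i ->
       exists2 l, A l & s l (emb r *: x) <= r * s i x) ->
  sublinear (fun x => inf [set s i x | i in A]).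
Proof.
move=> [i0 Ai0] lb sD sZ.
have ne x : [set s i x | i in A] !=set0 by exists (s i0 x), i0.
have infle i x : A i -> inf [set s i x | i in A] <= s i x.
  by move=> Ai; apply: ge_inf => //; exists i.
split=> [x y|r x r0].
  apply/ler_addgt0Pr => e e0; have e2 : 0 < e / 2 by lra.
  have [_ [i Ai <-] hi] := inf_adherent e2 (conj (ne x) (lb x)).
  have [_ [j Aj <-] hj] := inf_adherent e2 (conj (ne y) (lb y)).
  have [l Al hl] := sD i j x y Ai Aj.
  have := infle l (x + y) Al; lra.
have [r_eq0|rn0] := eqVneq r 0.
  have [l Al] := sZ i0 r x r0 Ai0; have := infle l (emb r *: x) Al.
  rewrite r_eq0 !mul0r; exact: le_trans.
have r_gt0 : 0 < r by rewrite lt0r rn0.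
rewrite -ler_pdivrMl //; apply: lb_le_inf => // _ [i Ai <-].
have [l Al hl] := sZ i r x r0 Ai.
by rewrite ler_pdivrMl // (le_trans (infle l _ Al)).
Qed.

Lemma minimal_sublinear p : sublinear p ->
  exists q, [/\ sublinear q, forall x, q x <= p x &
    forall q', sublinear q' -> (forall x, q' x <= q x) -> q' = q].
Proof.
move=> sp; pose T := {q | sublinear q /\ forall x, q x <= p x}.
(* The order is reversed, so that a maximal element is a minimal functional. Chains are bounded by
   pointwise infima, which are finite because [- p (- x)] is a lower bound. *)
pose rel (s t : T) := `[< forall x, sval t x <= sval s x >].
have [|||A tot|[q [sq qp]] qmin] := @Zorn T rel.
- by move=> t; apply/asboolP.
- move=> r s t /asboolP rs /asboolP st; apply/asboolP => x.
  exact: le_trans (st x) (rs x).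
- move=> s t /asboolP st /asboolP ts; apply: eq_sig_hprop => [? ? ?|]; [exact: Prop_irrelevance|].
  apply/funext => x.
  by apply/eqP; rewrite eq_le st ts.
- have [->|/set0P[t0 At0]] := eqVneq A set0.
    by exists (exist _ p (conj sp (fun x => lexx _))).
  have lb x : has_lbound [set sval i x | i in A].
    exists (- p (- x)) => _ [i Ai <-]; have [si ip] := svalP i.
    have := sublinear_ge0 x si; have := ip (- x); lra.
  pose q x := inf [set sval i x | i in A].
  have qle i x : A i -> q x <= sval i x by move=> Ai; apply: ge_inf => //; exists i.
  have sq : sublinear q.
    apply: sublinear_inf => //; first by exists t0.
      move=> i j x y Ai Aj; have [si _] := svalP i; have [sj _] := svalP j.
      have [/asboolP ij|/asboolP ji] := tot i j Ai Aj.
        by exists j => //; rewrite (le_trans (sj.1 x y)) // lerD2r.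
      by exists i => //; rewrite (le_trans (si.1 x y)) // lerD2l.
    move=> i r x r0 Ai; exists i => //; have [si _] := svalP i; exact: si.2.
  have qp x : q x <= p x by rewrite (le_trans (qle _ _ At0)) //; apply: (svalP t0).2.
  exists (exist _ q (conj sq qp)) => s As; apply/asboolP => x; exact: qle.
exists q; split=> // q' sq' q'q.
have q'p x : q' x <= p x by rewrite (le_trans (q'q x)).
have := qmin (exist _ q' (conj sq' q'p)).
by move=> /(_ (asboolT q'q)) /(congr1 sval).
Qed.

(* The largest sublinear functional below p whose value at -y is at most -p y. *)
Definition tilt p y x := inf [set p (x + emb t *: y) - t * p y | t in [set t | 0 <= t]].

Lemma tiltP p y : sublinear p ->
  [/\ sublinear (tilt p y), forall x, tilt p y x <= p x & tilt p y (- y) <= - p y].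
Proof.
move=> sp; have [pD pZ] := sp.
have lb x : has_lbound [set p (x + emb t *: y) - t * p y | t in [set t | 0 <= t]].
  exists (- p (- x)) => _ [t /= t0 <-]; rewrite -sublinearZ //.
  by have := pD (x + emb t *: y) (- x); rewrite addrC addKr; lra.
have tle x t : 0 <= t -> tilt p y x <= p (x + emb t *: y) - t * p y.
  by move=> t0; apply: ge_inf => //; exists t.
split.
- apply: (@sublinear_inf _ _ (fun t x => p (x + emb t *: y) - t * p y)) => //.
  + by exists 0 => /=.
  + move=> t u v w /= t0 u0; exists (t + u); first exact: addr_ge0.
    rewrite rmorphD scalerDl addrACA; have := pD (v + emb t *: y) (w + emb u *: y); lra.
  + move=> t r x r0 /= t0; exists (r * t); first exact: mulr_ge0.
    rewrite rmorphM -scalerA -scalerDr mulrBr -mulrA lerD2r; exact: pZ.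
- by move=> x; have := tle x 0 (lexx 0); rewrite rmorph0 scale0r addr0 mul0r subr0.
- have := tle (- y) 1 ler01; rewrite rmorph1 scale1r addNr mul1r.
  by have := sublinearZ 0 sp (lexx 0); rewrite rmorph0 scale0r mul0r => ->; rewrite sub0r.
Qed.

(** Tilting [p] at [x0] before minimizing forces the value at [x0]. A minimal functional is odd,
    because tilting it at any [y] cannot lower it, and an odd sublinear functional is real
    linear. *)
Lemma hahn_banach p x0 : sublinear p ->
  exists f : V -> R, [/\ zmod_morphism f, forall r x, f (emb r *: x) = r * f x,
    forall x, f x <= p x & f x0 = p x0].
Proof.
move=> sp; have [sp0 p0p p0x0] := tiltP x0 sp.
have [q [sq qp0 qmin]] := minimal_sublinear sp0.
have qN y : q (- y) = - q y.
  have [sqy qyq hy] := tiltP y sq; rewrite (qmin _ sqy qyq) in hy.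
  by apply/eqP; rewrite eq_le hy /=; have := sublinear_ge0 y sq; lra.
have [qD _] := sq.
exists q; split.
- move=> x y; apply/eqP; rewrite eq_le; apply/andP; split.
    by rewrite -[in leRHS]qN qD.
  by have := qD (x - y) y; rewrite subrK; lra.
- move=> r x; have [r0|r0] := leP 0 r; first exact: sublinearZ.
  rewrite -[r in LHS]opprK rmorphN scaleNr qN sublinearZ //; last lra.
  by rewrite mulNr opprK.
- by move=> x; rewrite (le_trans (qp0 x)).
- apply/eqP; rewrite eq_le (le_trans (qp0 _)) //=.
  by have := qp0 (- x0); rewrite qN; lra.
Qed.

End HahnBanach.

(** * Real-valued norms and operator norms *)

Section Norms.
Context {R : realType} {k : scalar_kind}.
Local Notation K := (scalar_field R k).
Implicit Types X Y Z : normedModType K.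

Lemma normE X (x : X) : `|x| = of_real (rnorm x).
Proof. by rewrite ger0_of_real. Qed.

Lemma rnorm_ge0 X (x : X) : 0 <= rnorm x.
Proof. by rewrite -(ler_of_real (k := k)) -normE of_real0. Qed.

Lemma rnorm0 X : rnorm (0 : X) = 0.
Proof. by rewrite /rnorm normr0 raddf0. Qed.

Lemma rnorm_eq0 X (x : X) : rnorm x = 0 -> x = 0.
Proof. by move=> h; apply/eqP; rewrite -normr_eq0 normE h of_real0. Qed.

Lemma rnormD X (x y : X) : rnorm (x + y) <= rnorm x + rnorm y.
Proof. by rewrite -(ler_of_real (k := k)) of_realD -!normE ler_normD. Qed.

Lemma rnormN X (x : X) : rnorm (- x) = rnorm x.
Proof. by rewrite /rnorm normrN. Qed.

Lemma rnormB X (x y : X) : rnorm (x - y) = rnorm (y - x).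
Proof. by rewrite -rnormN opprB. Qed.

Lemma rnorm_sub X (x y : X) : rnorm x - rnorm y <= rnorm (x - y).
Proof. by have := rnormD (x - y) y; rewrite subrK; lra. Qed.

Lemma rnormZ X (a : K) (x : X) : rnorm (a *: x) = re_part `|a| * rnorm x.
Proof. by rewrite /rnorm normrZ -(ger0_of_real (normr_ge0 a)) re_partM of_realK. Qed.

Lemma re_part1 : re_part (1 : K) = 1 :> R.
Proof. by rewrite -(of_real1 (k := k)) of_realK. Qed.

Lemma rnormZ1 X (w : K) (x : X) : `|w| = 1 -> rnorm (w *: x) = rnorm x.
Proof. by move=> w1; rewrite rnormZ w1 re_part1 mul1r. Qed.

Lemma norm_of_real r : `|of_real r : K| = of_real `|r|.
Proof.
wlog r0 : r / 0 <= r => [h|].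
  have [|r0] := leP 0 r; first exact: h.
  by rewrite -normrN -of_realN h ?normrN //; lra.
by rewrite (ger0_norm r0) ger0_norm // -(of_real0 (k := k)) ler_of_real.
Qed.

Lemma rnormZr X r (x : X) : rnorm (of_real r *: x) = `|r| * rnorm x.
Proof. by rewrite rnormZ norm_of_real of_realK. Qed.

Lemma nbhs_rnormP X (x : X) (A : set X) :
  nbhs x A <-> exists2 e : R, 0 < e & forall y, rnorm (x - y) < e -> A y.
Proof.
have ltE (r s : R) : ((of_real r : K) < of_real s) = (r < s).
  by rewrite !lt_def !ler_of_real (inj_eq (can_inj of_realK)).
split=> [/nbhs_normP[e /= e0 h]|[e e0 h]].
  have eE : of_real (re_part e) = e by rewrite ger0_of_real // ltW.
  exists (re_part e) => [|y hy]; first by rewrite -ltE eE of_real0.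
  by apply: h; rewrite /ball_ /= normE -eE ltE.
apply/nbhs_normP; exists (of_real e) => /=; first by rewrite -of_real0 ltE.
by move=> y; rewrite /ball_ /= normE ltE; exact: h.
Qed.

Lemma closure_rnormP X (A : set X) (x : X) :
  closure A x <-> forall e : R, 0 < e -> exists2 y, A y & rnorm (x - y) < e.
Proof.
split=> [clA e e0|h B /nbhs_rnormP[e e0 hB]].
  have /clA[y [Ay hy]] : nbhs x [set y | rnorm (x - y) < e].
    by apply/nbhs_rnormP; exists e.
  by exists y.
by have [y Ay hy] := h e e0; exists y; split=> //; exact: hB.
Qed.

Lemma continuous_rnorm_bound X Y (T : {linear X -> Y}) : continuous T ->
  exists2 C : R, 0 < C & forall x, rnorm (T x) <= C * rnorm x.
Proof.
move=> /(_ 0) /(_ [set y | rnorm y < 1]) hT.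
have /hT /nbhs_rnormP[e e0 he] : nbhs (T 0) [set y | rnorm y < 1].
  apply/nbhs_rnormP; exists 1 => // y; rewrite linear0.
  by rewrite sub0r rnormN.
exists (2 / e) => [|x]; first by rewrite divr_gt0.
have [x0|xn0] := eqVneq (rnorm x) 0.
  by rewrite (rnorm_eq0 x0) linear0 !rnorm0 mulr0.
have x_gt0 : 0 < rnorm x by rewrite lt0r xn0 rnorm_ge0.
(* This factor rescales [x] to norm [e / 2], inside the ball on which [T] has norm below 1. *)
pose r := e / (2 * rnorm x).
have r0 : 0 < r by rewrite divr_gt0 // mulr_gt0.
have /= := he (of_real r *: x).
rewrite sub0r rnormN linearZ /= !rnormZr gtr0_norm //.
have -> : r * rnorm x = e / 2 by rewrite /r; field.
move=> /(_ ltac:(lra)) h.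
have -> : 2 / e * rnorm x = r^-1 by rewrite /r; field; rewrite xn0 gt_eqF.
by rewrite -[leRHS]mulr1 ler_pdivlMl // ltW.
Qed.

Lemma rnorm_bound_continuous X Y (T : {linear X -> Y}) (C : R) :
  (forall x, rnorm (T x) <= C * rnorm x) -> continuous T.
Proof.
move=> hT x A /nbhs_rnormP[e e0 hA]; apply/nbhs_rnormP.
have C0 : 0 < `|C| + 1 by rewrite ltr_wpDl.
exists (e / (`|C| + 1)) => [|y]; first by rewrite divr_gt0.
rewrite ltr_pdivlMr // => h; apply: hA; rewrite -linearB.
apply: le_lt_trans (hT _) (le_lt_trans _ h); rewrite mulrC ler_wpM2l ?rnorm_ge0 //.
by have := ler_norm C; lra.
Qed.

Lemma unit_ball0 X : unit_ball (0 : X).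
Proof. by rewrite /unit_ball /= rnorm0. Qed.

(** Some bound [C] must be supplied, since the real [sup] of an unbounded set is a default value. *)
Lemma rnorm_le_opnorm X Y (T : X -> Y) (C : R) (x : X) :
  (forall x, unit_ball x -> rnorm (T x) <= C) -> unit_ball x -> rnorm (T x) <= opnorm T.
Proof.
by move=> hC Bx; apply: ub_le_sup; [exists C => _ [y By <-]; exact: hC|exists x].
Qed.

Lemma opnorm_le X Y (T : X -> Y) (C : R) :
  (forall x, unit_ball x -> rnorm (T x) <= C) -> opnorm T <= C.
Proof.
move=> hC; apply: ge_sup => [|_ [y By <-]]; last exact: hC.
by exists (rnorm (T 0)), 0 => //; exact: unit_ball0.
Qed.

Lemma opnorm_adherent X Y (T : X -> Y) (e : R) : 0 < e ->
  (exists C, forall x, unit_ball x -> rnorm (T x) <= C) ->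
  exists2 x, unit_ball x & opnorm T - e < rnorm (T x).
Proof.
move=> e0 [C hC].
have [|_ [x Bx <-]] := @sup_adherent R [set rnorm (T x) | x in @unit_ball R k X] e e0.
  split; first by exists (rnorm (T 0)), 0 => //; exact: unit_ball0.
  by exists C => _ [y By <-]; exact: hC.
by exists x.
Qed.

Lemma rnorm_bound_ball X Y (T : X -> Y) (C : R) : 0 <= C ->
  (forall x, rnorm (T x) <= C * rnorm x) -> forall x, unit_ball x -> rnorm (T x) <= C.
Proof. by move=> C0 hC x Bx; rewrite (le_trans (hC x)) // ler_piMr. Qed.

Lemma rnorm_le_opnormM X Y (T : {linear X -> Y}) (x : X) : continuous T ->
  rnorm (T x) <= opnorm T * rnorm x.
Proof.
move=> /continuous_rnorm_bound[C C0 hC].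
have [x0|xn0] := eqVneq (rnorm x) 0.
  by rewrite (rnorm_eq0 x0) linear0 !rnorm0 mulr0.
have x_gt0 : 0 < rnorm x by rewrite lt0r xn0 rnorm_ge0.
have i0 : 0 <= (rnorm x)^-1 by rewrite invr_ge0 ltW.
rewrite -ler_pdivrMr // mulrC -[(rnorm x)^-1]ger0_norm // -rnormZr -linearZ.
apply: (rnorm_le_opnorm (T := T) (rnorm_bound_ball (ltW C0) hC)).
by rewrite /unit_ball /= rnormZr ger0_norm ?mulVf.
Qed.

End Norms.

(** * Convex hulls with real coefficients *)

Section ConvexHulls.
Context {R : realType} {k : scalar_kind}.
Local Notation K := (scalar_field R k).
Implicit Types X Y Z : normedModType K.

(** Convexity is defined with coefficients in the unit interval of [K]; these are nonnegative
    elements of [K], hence real. *)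
Lemma convex_set_realP X (A : set X) : @convex_set K X A <->
  forall (t : R) x y, 0 <= t -> t <= 1 -> A x -> A y ->
    A (of_real t *: x + of_real (1 - t) *: y).
Proof.
split=> [cA t x y t0 t1 Ax Ay|cA x y l /set_mem Ax /set_mem Ay].
  have t0' : 0 <= (of_real t : K) by rewrite -of_real0 ler_of_real.
  have t1' : (of_real t : K) <= 1 by rewrite -of_real1 ler_of_real.
  have := cA x y (Itv01 t0' t1') (mem_set Ax) (mem_set Ay).
  by move=> /set_mem; rewrite of_realB of_real1.
have l0 : 0 <= l%:num by [].
have := l; have := cA (re_part l%:num) x y.
rewrite of_realB of_real1 ger0_of_real // => h _; apply/mem_set; apply: h => //.
  by rewrite -(ler_of_real (k := k)) ger0_of_real // of_real0.
by rewrite -(ler_of_real (k := k)) ger0_of_real // of_real1.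
Qed.

Lemma conv_hull_convex X (A : set X) (t : R) x y : 0 <= t -> t <= 1 ->
  conv_hull A x -> conv_hull A y -> conv_hull A (of_real t *: x + of_real (1 - t) *: y).
Proof.
move=> t0 t1 hx hy C [cC AC].
by have /convex_set_realP := cC; apply => //; [exact: hx|exact: hy].
Qed.

Lemma sub_conv_hull X (A : set X) : A `<=` conv_hull A.
Proof. exact: sub_gen_smallest. Qed.

Lemma conv_hull_min X (A C : set X) : A `<=` C ->
  (forall (t : R) x y, 0 <= t -> t <= 1 -> C x -> C y ->
    C (of_real t *: x + of_real (1 - t) *: y)) ->
  conv_hull A `<=` C.
Proof. by move=> AC /convex_set_realP cC; apply: smallest_sub. Qed.

Lemma conv_hullS X (A B : set X) : A `<=` B -> conv_hull A `<=` conv_hull B.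
Proof.
move=> AB; apply: conv_hull_min => [x /AB|t x y]; first exact: sub_conv_hull.
exact: conv_hull_convex.
Qed.

(** A sequence stands in for the finite support of a convex combination, so that countably many
    operations, one for each term, can produce it. The induction interleaves two sequences by
    parity. *)
Lemma conv_hull_countable X (A : set X) x : conv_hull A x ->
  exists2 s : nat -> X, forall n, A (s n) & conv_hull (range s) x.
Proof.
move: x; apply: conv_hull_min => [x Ax|t x y t0 t1 [s sA hs] [s' sA' hs']].
  by exists (fun=> x) => //; apply: sub_conv_hull; exists 0%N.
exists (fun n => if odd n then s n./2 else s' n./2) => [n|]; first by case: ifP.
apply: conv_hull_convex => //.
  apply: conv_hullS hs => _ [n _ <-]; exists n.*2.+1 => //.
  by rewrite /= odd_double /= uphalf_double.
apply: conv_hullS hs' => _ [n _ <-]; exists n.*2 => //.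
by rewrite odd_double doubleK.
Qed.

Lemma unit_ball_convex X (t : R) (x y : X) : 0 <= t -> t <= 1 ->
  unit_ball x -> unit_ball y -> unit_ball (of_real t *: x + of_real (1 - t) *: y).
Proof.
rewrite /unit_ball /= => t0 t1 hx hy; apply: (le_trans (rnormD _ _)).
by rewrite !rnormZr !ger0_norm ?subr_ge0 //; nra.
Qed.

End ConvexHulls.

(** * Scalar functionals dominated in modulus *)

Section FunctionalExtension.
Context {R : realType} {k : scalar_kind}.
Local Notation K := (scalar_field R k).

(** Invariance of [p] under unit scalars upgrades the bound on the real part to one on the modulus:
    rotate [x] until [g x] equals its modulus. *)
Lemma hahn_banach_functional (V : lmodType K) (p : V -> R) (x0 : V) :
    sublinear (@of_real R k) p -> (forall (w : K) x, `|w| = 1 -> p (w *: x) <= p x) ->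
  exists g : {linear V -> K^o},
    (forall x, re_part `|g x : K| <= p x) /\ p x0 <= re_part `|g x0 : K|.
Proof.
move=> sp pw; have [f [fD fZ fp fx0]] := hahn_banach x0 sp.
have [g gf] := complexify fD fZ; exists g; split=> [x|].
  have [w w1 <-] := ex_phase (g x : K).
  have -> : w * g x = g (w *: x) by rewrite linearZ.
  by rewrite gf (le_trans (fp _)) // pw.
by rewrite -fx0 -gf re_part_le_norm.
Qed.

End FunctionalExtension.

(** * Rank-one tests of the alternative Daugavet property *)

Section AlternativeDaugavet.
Context {R : realType} {k : scalar_kind}.
Local Notation K := (scalar_field R k).
Context {X Y : normedModType K} (G : {linear X -> Y}).
Hypotheses (hG : continuous G) (hADP : alternative_Daugavet G).

Lemma unit_scalar1 : @unit_scalars R k 1.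
Proof. exact: normr1. Qed.

Lemma alternative_Daugavet_opnorm : opnorm G = 1.
Proof.
have c0 : continuous (\0 : {linear X -> Y}).
  by apply: (@rnorm_bound_continuous _ _ _ _ _ 0) => x; rewrite mul0r rnorm0.
have r0 : rank_at_most_one (\0 : {linear X -> Y}).
  by exists 0 => x; exists 0; rewrite scale0r.
have := hADP c0 r0.
have -> : opnorm (\0 : {linear X -> Y}) = 0.
  apply/eqP; rewrite eq_le; apply/andP; split.
    by apply: opnorm_le => x _; rewrite rnorm0.
  apply: le_trans (rnorm_ge0 (\0 (0 : X) : Y)) _.
  by apply: (rnorm_le_opnorm (C := 0)); [move=> x _; rewrite rnorm0|exact: unit_ball0].
have -> : [set opnorm (G \+ w \*: (\0 : {linear X -> Y})) | w in unit_scalars] = [set opnorm G].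
  have E (w : K) : G \+ w \*: (\0 : {linear X -> Y}) = G :> (X -> Y).
    by apply/funext => x /=; rewrite scaler0 addr0.
  apply/seteqP; split=> [_ [w _ <-]|_ ->]; first by rewrite /= E.
  by exists 1; [exact: unit_scalar1|rewrite E].
by rewrite sup1 addr0.
Qed.

Lemma rnorm_le_ball x : unit_ball x -> rnorm (G x) <= 1.
Proof.
move=> Bx; rewrite (le_trans (rnorm_le_opnormM x hG)) //.
by rewrite alternative_Daugavet_opnorm mul1r.
Qed.

Lemma opnorm_add_scale (T : {linear X -> Y}) (w : K) x : continuous T ->
  `|w| = 1 -> unit_ball x -> rnorm ((G \+ w \*: T) x) <= 1 + opnorm T.
Proof.
move=> cT w1 Bx /=; rewrite (le_trans (rnormD _ _)) // rnormZ1 // lerD ?rnorm_le_ball //.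
have [C C0 hC] := continuous_rnorm_bound cT.
exact: (rnorm_le_opnorm (T := T) (rnorm_bound_ball (ltW C0) hC)).
Qed.

(** The test operator sends [x] to [f x / opnorm f] times [z]. A point [x] nearly attaining the norm
    of [G + w T] has [rnorm (f x)] close to [opnorm f]. Rotating it turns [w *: T x] into a multiple
    [a *: z] with [a] real and near 1, which can then be replaced by [z]. *)
Lemma rank_one_witness (f : {linear X -> K^o}) (z : Y) (e : R) :
    continuous f -> 0 < opnorm f -> z != 0 -> 0 < e ->
  exists u, [/\ unit_ball u, 1 + rnorm z - e < rnorm (G u + z)
    & opnorm f * (1 - e) < rnorm (f u)].
Proof.
move=> cf; set M := opnorm f => M0 z0 e0.
have nz : 0 < rnorm z.
  by rewrite lt0r rnorm_ge0 andbT; apply: contra_neq z0; exact: rnorm_eq0.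
have Mi0 : 0 <= M^-1 by rewrite invr_ge0 ltW.
pose h x := (of_real M^-1 * (f x : K)) *: z.
have lh : linear h.
  by move=> a x y; rewrite /h linearP mulrDr scalerDl [in RHS]scalerA mulrCA.
pose mh := GRing.isLinear.Build K X Y *:%R h lh.
have [T TE] : exists T : {linear X -> Y}, forall x, T x = h x.
  by exists (HB.pack_for {linear X -> Y} h mh).
have hT x : rnorm (T x) = M^-1 * rnorm (f x) * rnorm z.
  by rewrite TE rnormZ normrM norm_of_real re_partM (ger0_norm Mi0).
have hf x : rnorm (f x) <= M * rnorm x by exact: rnorm_le_opnormM.
have cT : continuous T.
  apply: (@rnorm_bound_continuous _ _ _ _ _ (rnorm z)) => x.
  rewrite hT mulrC ler_wpM2l ?rnorm_ge0 // ler_pdivrMl //; exact: hf.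
have rT : rank_at_most_one T.
  by exists z => x; exists (of_real M^-1 * (f x : K)); rewrite TE.
have [C C0 hC] := continuous_rnorm_bound cT.
have zT : rnorm z <= opnorm T.
  apply/ler_addgt0Pr => d d0.
  have [||x Bx hx] := opnorm_adherent (T := f) (e := M * (d / rnorm z)).
  - by rewrite mulr_gt0 // divr_gt0.
  - exists M; apply: rnorm_bound_ball => //; exact: ltW.
  have := rnorm_le_opnorm (T := T) (rnorm_bound_ball (ltW C0) hC) Bx.
  rewrite hT -/M => h1.
  suff : rnorm z - d <= M^-1 * rnorm (f x) * rnorm z by lra.
  have -> : rnorm z - d = (1 - d / rnorm z) * rnorm z by field; rewrite gt_eqF.
  rewrite ler_wpM2r ?rnorm_ge0 // ler_pdivlMl //; move: hx; rewrite -/M; lra.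
(* Choosing [w] and then [x] loses [d] each, and replacing [a *: z] by [z] loses at most [2 * d]
   more, so [4 * d <= e] is wanted. The bound [4 * d <= e * rnorm z] makes [a] exceed [1 - e]. *)
pose d := e * Num.min 1 (rnorm z) / 4.
have m0 : 0 < Num.min 1 (rnorm z) by rewrite lt_min ltr01.
have d0 : 0 < d by rewrite divr_gt0 // mulr_gt0.
have d1 : 4 * d <= e.
  have -> : 4 * d = e * Num.min 1 (rnorm z) by rewrite /d; field.
  by rewrite ler_piMr ?ge_min ?lexx // ltW.
have d2 : 4 * d <= e * rnorm z.
  have -> : 4 * d = e * Num.min 1 (rnorm z) by rewrite /d; field.
  by rewrite ler_wpM2l ?ge_min ?lexx ?orbT // ltW.
have hs : has_sup [set opnorm (G \+ w \*: T) | w in unit_scalars].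
  split; first by exists (opnorm (G \+ 1 \*: T)), 1 => //; exact: unit_scalar1.
  exists (1 + opnorm T) => _ [w w1 <-]; apply: opnorm_le => x Bx.
  exact: opnorm_add_scale.
have [_ [w w1 <-]] := sup_adherent d0 hs; rewrite hADP // => hw.
have [|x Bx hx] := opnorm_adherent (T := G \+ w \*: T) d0.
  by exists (1 + opnorm T) => x; exact: opnorm_add_scale.
have hx' : 1 + rnorm z - 2 * d < rnorm (G x + w *: T x).
  by move: hx; rewrite /=; lra.
pose a := M^-1 * rnorm (f x).
have Ta : rnorm (T x) = a * rnorm z by rewrite hT.
have a1 : a <= 1.
  rewrite ler_pdivrMl // mulr1 (le_trans (hf x)) // ler_piMr //; exact: ltW.
have a_ge : rnorm z - 2 * d < a * rnorm z.
  have := rnormD (G x) (w *: T x); rewrite rnormZ1 // Ta.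
  by have := rnorm_le_ball Bx; lra.
have [c c1 cE] := ex_phase (f x : K).
have w0 : w != 0 by rewrite -normr_eq0 w1 oner_eq0.
have cw1 : `|c / w| = 1 by rewrite normrM normfV w1 c1 divr1.
exists ((c / w) *: x); split.
- by rewrite /unit_ball /= rnormZ1.
- have GZ b v : G (b *: v) = b *: G v by rewrite linearZ.
  have E : rnorm (G x + w *: T x) = rnorm (G ((c / w) *: x) + of_real a *: z).
    rewrite -[LHS](rnormZ1 _ cw1) scalerDr TE GZ; congr (rnorm (_ + _)).
    rewrite scalerA divfK // /h scalerA mulrCA cE normE -of_realM.
    by rewrite /a /rnorm.
  have S : G ((c / w) *: x) + z - of_real (1 - a) *: z = G ((c / w) *: x) + of_real a *: z.
    rewrite of_realB of_real1 scalerBl scale1r opprB -addrA; congr (_ + _).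
    by rewrite addrC subrK.
  have := rnormD (G ((c / w) *: x) + z) (- (of_real (1 - a) *: z)).
  rewrite S -E rnormN rnormZr ger0_norm ?subr_ge0 // mulrBl mul1r; lra.
- rewrite linearZ /= (rnormZ1 (f x) cw1).
  have -> : rnorm (f x) = M * a by rewrite /a mulrA mulfV ?mul1r // gt_eqF.
  rewrite ltr_pM2l //.
  suff : (1 - e) * rnorm z < a * rnorm z by rewrite ltr_pM2r.
  by rewrite mulrBl mul1r; lra.
Qed.

End AlternativeDaugavet.

(** * Density in the unit ball of absolutely convex combinations of witnesses *)

Section Witnesses.
Context {R : realType} {k : scalar_kind}.
Local Notation K := (scalar_field R k).
Context {X Y : normedModType K} (G : {linear X -> Y}).

(** Including all rotations makes the ordinary convex hull of this set the absolutely convex hull of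
    the set [W(z)]. *)
Definition rotated_witnesses (z : Y) (e : R) : set X :=
  [set w *: u | w in @unit_scalars R k
              & u in [set u | unit_ball u /\ 1 + rnorm z - e < rnorm (G u + z)]].

Lemma rotated_witnesses_ball z e : rotated_witnesses z e `<=` @unit_ball R k X.
Proof. by move=> _ [w w1 [u [Bu _] <-]]; rewrite /unit_ball /= rnormZ1. Qed.

Lemma conv_rotated_witnessesZ z e (w : K) : `|w| = 1 -> forall c,
  conv_hull (rotated_witnesses z e) c -> conv_hull (rotated_witnesses z e) (w *: c).
Proof.
move=> w1; apply: conv_hull_min => [_ [v v1 [u hu <-]]|t x y t0 t1 hx hy].
  apply: sub_conv_hull; exists (w * v); last by exists u => //; rewrite scalerA.
  by rewrite /unit_scalars /= normrM w1 v1 mulr1.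
have -> : w *: (of_real t *: x + of_real (1 - t) *: y) =
    of_real t *: (w *: x) + of_real (1 - t) *: (w *: y).
  by rewrite scalerDr !scalerA ![w * _]mulrC.
exact: conv_hull_convex.
Qed.

Hypotheses (hG : continuous G) (hADP : alternative_Daugavet G).

(** The rank-one test needs a nonzero functional. Since [opnorm G = 1], some [x] is nonzero, and
    Hahn-Banach for the norm gives a functional that does not vanish there. *)
Lemma ex_rotated_witness z e : z != 0 -> 0 < e -> rotated_witnesses z e !=set0.
Proof.
move=> z0 e0; have G1 := alternative_Daugavet_opnorm hADP.
have [C C0 hC] := continuous_rnorm_bound hG.
have [|x Bx] := opnorm_adherent (T := G) ltr01.
  by exists C; apply: rnorm_bound_ball (ltW C0) hC.
rewrite G1 subrr => Gx0.
have x0 : 0 < rnorm x.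
  rewrite lt0r rnorm_ge0 andbT; apply/eqP => /rnorm_eq0 x0.
  by move: Gx0; rewrite x0 linear0 rnorm0 ltxx.
have [||g [gle gx]] := @hahn_banach_functional R k X (fun x => rnorm x) x.
- split=> [u v|r u r0]; first exact: rnormD.
  by rewrite rnormZr ger0_norm.
- by move=> w u w1; rewrite rnormZ1.
have hg (u : X) : rnorm (g u) <= 1 * rnorm u by rewrite mul1r; exact: gle.
have cg : continuous g by exact: rnorm_bound_continuous hg.
have g0 : 0 < opnorm g.
  apply: (lt_le_trans x0); apply: (le_trans gx).
  exact: (rnorm_le_opnorm (T := g) (rnorm_bound_ball ler01 hg)).
have [u [Bu hu _]] := rank_one_witness hG hADP cg g0 z0 e0.
by exists u, 1; [exact: unit_scalar1|exists u => //; rewrite scale1r].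
Qed.

(** The hull is symmetric, and [t] times [c] is the average of [c] and [- c] with weights
    [(1 + t) / 2] and [(1 - t) / 2]. *)
Lemma conv_rotated_witnesses_star z e (t : R) c : 0 <= t -> t <= 1 ->
  conv_hull (rotated_witnesses z e) c -> conv_hull (rotated_witnesses z e) (of_real t *: c).
Proof.
move=> t0 t1 hc.
have hNc : conv_hull (rotated_witnesses z e) (- c).
  by rewrite -scaleN1r; apply: conv_rotated_witnessesZ => //; rewrite normrN normr1.
have -> : of_real t *: c = of_real ((1 + t) / 2) *: c + of_real (1 - (1 + t) / 2) *: (- c).
  rewrite scalerN -scalerBl -of_realB; congr (of_real _ *: _); lra.
by apply: conv_hull_convex => //; lra.
Qed.

(** If the hull [A] stayed at distance [d] from [x], a functional [g] of modulus at most 1 on [A]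
    would have norm at least [1 + d / 4], while [rank_one_witness] finds a point of [A] where the
    modulus of [g] is nearly its norm. *)
Lemma conv_rotated_witnesses_dense z e x d : z != 0 -> 0 < e -> 0 < d -> unit_ball x ->
  exists2 v, conv_hull (rotated_witnesses z e) v & rnorm (x - v) < d.
Proof.
move=> z0 e0; wlog d1 : d / d <= 1 => [h d0 Bx|d0 Bx].
  have [|d1] := leP d 1; first by move=> d1; exact: h.
  have [v hv hxv] := h 1 (lexx _) ltr01 Bx.
  by exists v => //; exact: lt_trans hxv d1.
set A := conv_hull _; apply: contrapT => hno.
have far v : A v -> d <= rnorm (x - v).
  by move=> Av; rewrite leNgt; apply/negP => h; apply: hno; exists v.
have AB c : A c -> rnorm c <= 1.
  move: c; apply: conv_hull_min; first exact: rotated_witnesses_ball.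
  by move=> t u v t0 t1; exact: unit_ball_convex.
have [a0 Aa0] : A !=set0.
  by have [s hs] := ex_rotated_witness z0 e0; exists s; exact: sub_conv_hull.
(* The infimum of [s] is the gauge of the convex hull of [A] and the ball of radius [d / 4]: it
   charges [t] for a part [t a] with [a] in [A], and [4 / d] times the norm of the rest. *)
pose I : set (R * X) := [set i | 0 <= i.1 /\ A i.2].
pose s (i : R * X) (v : X) := i.1 + rnorm (v - of_real i.1 *: i.2) * (4 / d).
have d4 : 0 < 4 / d by rewrite divr_gt0.
pose p v := inf [set s i v | i in I].
have s0 i v : I i -> 0 <= s i v.
  by move=> [i0 _]; rewrite addr_ge0 // mulr_ge0 ?rnorm_ge0 // ltW.
have lb v : has_lbound [set s i v | i in I].
  by exists 0 => _ [i Ii <-]; exact: s0.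
have ple i v : I i -> p v <= s i v by move=> Ii; apply: ge_inf => //; exists i.
have sp : sublinear (@of_real R k) p.
  apply: (@sublinear_inf R K (@of_real R k) X _ I s) => //.
  - by exists (0, a0); split => /=.
  - move=> [t c] [u c'] v v' [/= t0 Ac] [/= u0 Ac'].
    (* When both weights vanish the ratio [t / (t + u)] is useless, and any point of [A] serves. *)
    have [tu0|tun0] := eqVneq (t + u) 0.
      have [-> ->] : t = 0 /\ u = 0 by split; lra.
      exists (0, a0); first by split => /=.
      rewrite /s /= of_real0 !scale0r !subr0 !add0r -mulrDl ler_wpM2r ?rnormD //.
      exact: ltW.
    have tu : 0 < t + u by rewrite lt0r tun0 addr_ge0.
    pose r := t / (t + u).
    have rE : (t + u) * r = t by rewrite /r; field.
    have rE' : (t + u) * (1 - r) = u by rewrite mulrBr rE; ring.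
    exists (t + u, of_real r *: c + of_real (1 - r) *: c').
      split => /=; first exact: ltW.
      apply: conv_hull_convex => //; first by rewrite divr_ge0 // ltW.
      by rewrite ler_pdivrMr // mul1r lerDl.
    rewrite /s /= scalerDr !scalerA -!of_realM rE rE'.
    have -> : v + v' - (of_real t *: c + of_real u *: c') =
        (v - of_real t *: c) + (v' - of_real u *: c') by rewrite opprD addrACA.
    rewrite [leRHS]addrACA -mulrDl lerD2l ler_wpM2r ?rnormD //; exact: ltW.
  - move=> [t c] r v r0 [/= t0 Ac]; exists (r * t, c).
      by split => //=; exact: mulr_ge0.
    by rewrite /s /= of_realM -scalerA -scalerBr rnormZr ger0_norm // mulrDr mulrA.
have pw (w : K) v : `|w| = 1 -> p (w *: v) <= p v.
  move=> w1; apply: lb_le_inf; first by exists (s (0, a0) v), (0, a0) => //; split => /=.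
  move=> _ [[t c] [/= t0 Ac] <-].
  have Iwc : I (t, w *: c) by split => //=; exact: conv_rotated_witnessesZ.
  apply: (le_trans (ple _ _ Iwc)); rewrite /s /=.
  have -> : w *: v - of_real t *: (w *: c) = w *: (v - of_real t *: c).
    by rewrite scalerBr !scalerA [w * _]mulrC.
  by rewrite rnormZ1.
have p_le v : p v <= 4 / d * rnorm v.
  have I0 : I (0, a0) by split => /=.
  by rewrite (le_trans (ple _ v I0)) // /s /= of_real0 scale0r subr0 add0r mulrC.
have p_A c : A c -> p c <= 1.
  move=> Ac; have I1 : I (1, c) by split => /=.
  by rewrite (le_trans (ple _ c I1)) // /s /= of_real1 scale1r subrr rnorm0 mul0r addr0.
have px : 1 + d / 4 <= p x.
  apply: lb_le_inf; first by exists (s (0, a0) x), (0, a0) => //; split => /=.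
  move=> _ [[t c] [/= t0 Ac] <-]; rewrite /s /=; set n := rnorm _.
  have n0 : 0 <= n by exact: rnorm_ge0.
  have Ed (b : R) : b <= n -> b * (4 / d) <= n * (4 / d) by move=> ?; rewrite ler_wpM2r // ltW.
  (* Three ranges of [t]. For [t <= 1] the multiple of [c] is in [A], at distance at least [d],
     which costs 4. For [t >= 1 + d / 4] the term [t] suffices. In between, the multiple is within
     [d / 4] of [c], so the distance is at least [d * (3 / 4)], which costs 3. *)
  have [t1|t1] := leP t 1.
    have /Ed : d <= n by apply: far; exact: conv_rotated_witnesses_star.
    have -> : d * (4 / d) = 4 by field; rewrite gt_eqF.
    by lra.
  have [t2|t2] := leP (1 + d / 4) t.
    have : 0 <= n * (4 / d) by rewrite mulr_ge0 // ltW.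
    by lra.
  have /Ed : d * (3 / 4) <= n.
    have := far c Ac; have := rnormD (x - of_real t *: c) (of_real (t - 1) *: c).
    have -> : x - of_real t *: c + of_real (t - 1) *: c = x - c.
      by rewrite of_realB of_real1 scalerBl scale1r addrA subrK.
    rewrite rnormZr ger0_norm ?subr_ge0; last exact: ltW.
    have := ler_wpM2l (ltac:(lra) : 0 <= t - 1) (AB c Ac); rewrite mulr1 -/n; lra.
  have -> : d * (3 / 4) * (4 / d) = 3 by field; rewrite gt_eqF.
  by lra.
have [g [gle gx]] := hahn_banach_functional x sp pw.
have hg v : rnorm (g v) <= 4 / d * rnorm v.
  by apply: le_trans (p_le v); exact: gle.
have cg : continuous g by exact: rnorm_bound_continuous hg.
have gM : 1 + d / 4 <= opnorm g.
  apply: (le_trans px); apply: (le_trans gx).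
  exact: (rnorm_le_opnorm (T := g) (rnorm_bound_ball (ltW d4) hg)).
have g0 : 0 < opnorm g by lra.
(* With [e' <= d / 8] and [d <= 1], the product [(1 + d / 4) * (1 - e')] exceeds 1, which
   contradicts the bound on [A]. *)
pose e' := Num.min e (d / 8).
have e'0 : 0 < e' by rewrite lt_min e0 divr_gt0.
have e'e : e' <= e by rewrite ge_min lexx.
have e'd : e' <= d / 8 by rewrite ge_min lexx orbT.
have [u [Bu hu gu]] := rank_one_witness hG hADP cg g0 z0 e'0.
have : rnorm (g u) <= 1.
  apply: le_trans (p_A u _); first exact: gle.
  apply: sub_conv_hull; exists 1; first exact: unit_scalar1.
  by exists u; [split => //; lra|rewrite scale1r].
have : (1 + d / 4) * (1 - e') <= opnorm g * (1 - e') by rewrite ler_wpM2r // subr_ge0; lra.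
nra.
Qed.

End Witnesses.

(** * Separable subspaces that contain enough witnesses *)

Lemma countable_op_closure (I : countType) (T : Type) (op : I -> T -> T -> T) (x0 : T) :
  exists D : set T, [/\ countable D, D x0 & forall i a b, D a -> D b -> D (op i a b)].
Proof.
(* Finite trees serve as formal terms: a node with an operation leaf and two subtrees is evaluated,
   and any other tree stands for [x0]. The type of trees is countable. *)
pose ev := fix ev (t : GenTree.tree I) : T :=
  match t with
  | GenTree.Node _ [:: GenTree.Leaf i; a; b] => op i (ev a) (ev b)
  | _ => x0
  end.
exists (range ev); split.
- exact: sub_countable (card_image_le ev setT) (countableP _).
- by exists (GenTree.Node 0 [::]).
- move=> i _ _ [a _ <-] [b _ <-].
  by exists (GenTree.Node 0 [:: GenTree.Leaf i; a; b]).
Qed.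

Section DeterminingSubspace.
Context {R : realType} {k : scalar_kind}.
Local Notation K := (scalar_field R k).

(** The radial retraction onto the unit ball. If [D] is closed under it, the points of [D] in the
    ball are dense in the ball of [closure D]. *)
Definition ball_proj {X : normedModType K} (x : X) : X := of_real (Num.max 1 (rnorm x))^-1 *: x.

Lemma ball_projP (X : normedModType K) (x : X) : unit_ball (ball_proj x).
Proof.
have m1 : 1 <= Num.max 1 (rnorm x) by rewrite le_max lexx.
rewrite /unit_ball /ball_proj /= rnormZr ger0_norm ?invr_ge0; last lra.
by rewrite ler_pdivrMl ?mulr1 ?le_max ?lexx ?orbT //; lra.
Qed.

(** Outside the ball, [a] moves by [rnorm a - 1], which is at most [rnorm (x - a)] because [x] has
    norm at most 1. *)
Lemma rnorm_sub_ball_proj (X : normedModType K) (x a : X) :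
  unit_ball x -> rnorm (x - ball_proj a) <= 2 * rnorm (x - a).
Proof.
rewrite /unit_ball /= => Bx; rewrite /ball_proj.
have [a1|a1] := leP (rnorm a) 1.
  rewrite invr1 of_real1 scale1r; have := rnorm_ge0 (x - a); lra.
have a0 : 0 < rnorm a by lra.
have := rnormD (x - a) (of_real (1 - (rnorm a)^-1) *: a).
have -> : x - a + of_real (1 - (rnorm a)^-1) *: a = x - of_real (rnorm a)^-1 *: a.
  by rewrite of_realB of_real1 scalerBl scale1r addrA subrK.
have i1 : (rnorm a)^-1 <= 1 by rewrite invf_le1 // ltW.
rewrite rnormZr ger0_norm ?subr_ge0 // mulrBl mul1r mulVf ?gt_eqF //.
have := rnorm_sub a x; rewrite (rnormB a x); lra.
Qed.

Lemma closure_subspace (X : normedModType K) (D : set X) (q : nat -> K) :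
    (forall a (e : R), 0 < e -> exists n, re_part `|a - q n| < e) ->
    D 0 -> (forall x y, D x -> D y -> D (x + y)) -> (forall n x, D x -> D (q n *: x)) ->
  is_closed_subspace (closure D).
Proof.
move=> qd D0 DD DZ; split; first exact: closed_closure.
- exact: subset_closure.
- move=> x y /closure_rnormP hx /closure_rnormP hy; apply/closure_rnormP => e e0.
  have e2 : 0 < e / 2 by lra.
  have [a Da ha] := hx _ e2; have [b Db hb] := hy _ e2.
  exists (a + b); first exact: DD.
  by rewrite opprD addrACA; apply: le_lt_trans (rnormD _ _) _; lra.
- move=> c x /closure_rnormP hx; apply/closure_rnormP => e e0.
  have x0 := rnorm_ge0 x.
  have e1 : 0 < e / 2 / (rnorm x + 1) by rewrite !divr_gt0 // ltr_wpDl.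
  have [n hn] := qd c _ e1; set r := re_part `|q n|.
  have r0 : 0 <= r by exact: (rnorm_ge0 (q n : K^o)).
  have e3 : 0 < e / 2 / (r + 1) by rewrite !divr_gt0 // ltr_wpDl.
  have [a Da ha] := hx _ e3; exists (q n *: a); first exact: DZ.
  have -> : c *: x - q n *: a = (c - q n) *: x + q n *: (x - a).
    by rewrite scalerBl scalerBr addrA subrK.
  apply: le_lt_trans (rnormD _ _) _; rewrite !rnormZ -/r.
  move: hn ha; rewrite !ltr_pdivlMr ?ltr_wpDl //.
  have := rnorm_ge0 (x - a); have := rnorm_ge0 (c - q n : K^o).
  rewrite /rnorm -/(rnorm x) -/(rnorm (x - a)); nra.
Qed.

Lemma ex_invS_lt (e : R) : 0 < e -> exists n : nat, n.+1%:R^-1 < e.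
Proof.
move=> e0; exists (Num.bound e^-1).
have ei : 0 <= e^-1 by rewrite invr_ge0 ltW.
rewrite -[ltRHS]invrK ltf_pV2 ?posrE ?invr_gt0 // ?ltr0Sn //.
by apply: (lt_trans (archi_boundP ei)); rewrite ltr_nat.
Qed.

Context {X Y : normedModType K} (G : {linear X -> Y}).
Hypotheses (hG : continuous G) (hADP : alternative_Daugavet G).

Lemma ex_determining_set (y : Y) (x0 : X) : exists D : set X,
  [/\ countable D, D x0, is_closed_subspace (closure D),
      forall a, D a -> D (ball_proj a) &
      forall (a b : X) (n : nat), D a -> D b -> unit_ball a -> y + G b != 0 ->
        exists2 c, conv_hull (rotated_witnesses G (y + G b) n.+1%:R^-1 `&` D) c
          & rnorm (a - c) < n.+1%:R^-1].
Proof.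
have [q qd] := @ex_dense_scalars R k.
have ws (i : X * X * nat) : exists s : nat -> X,
    unit_ball i.1.1 -> y + G i.1.2 != 0 ->
    (forall m, rotated_witnesses G (y + G i.1.2) i.2.+1%:R^-1 (s m)) /\
    exists2 c, conv_hull (range s) c & rnorm (i.1.1 - c) < i.2.+1%:R^-1.
  have [[Ba z0]|h] := pselect (unit_ball i.1.1 /\ y + G i.1.2 != 0); last first.
    by exists (fun=> 0) => Ba z0; exfalso; exact: h.
  have n0 : 0 < i.2.+1%:R^-1 :> R by rewrite invr_gt0 ltr0Sn.
  have [c hc ac] := conv_rotated_witnesses_dense hG hADP z0 n0 n0 Ba.
  have [s sW sc] := conv_hull_countable hc.
  by exists s => _ _; split => //; exists c.
have [w hw] := choice ws.
(* The [inl] indices code the sum, [ball_proj], zero and the multiples by [q n]. When [a] is in the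
   ball and [y + G b] is nonzero, [inr (n, m)] returns term [m] of a sequence of rotated witnesses
   for [y + G b] whose hull comes within [n.+1%:R^-1] of [a]. *)
pose op (i : nat + nat * nat) (a b : X) : X :=
  match i with
  | inl 0 => a + b
  | inl 1 => ball_proj a
  | inl 2 => 0
  | inl n.+3 => q n *: a
  | inr nm => w (a, b, nm.1) nm.2
  end.
have [D [cD Dx0 Dop]] := countable_op_closure op x0.
exists D; split => //.
- apply: (closure_subspace qd).
  + exact: (Dop (inl 2%N) x0 x0 Dx0 Dx0).
  + by move=> a b Da Db; exact: (Dop (inl 0%N) a b Da Db).
  + by move=> n a Da; exact: (Dop (inl n.+3) a a Da Da).
- by move=> a Da; exact: (Dop (inl 1%N) a a Da Da).
- move=> a b n Da Db Ba z0; have [wW [c hc ac]] := hw (a, b, n) Ba z0.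
  exists c => //; apply: conv_hullS hc => _ [m _ <-]; split; first exact: wW.
  exact: (Dop (inr (n, m)) a b Da Db).
Qed.

(** To pass from the countable set [D] to its closure, [v] and [x] are replaced by nearby points [b]
    and [a] of [D], with [ball_proj] keeping [a] in the ball. A witness for [y + G b] is one for
    [y + G v] with a slightly larger tolerance. *)
Lemma ex_determining_subspace (y : Y) (x0 : X) : exists X0 : set X,
  [/\ is_closed_subspace X0, is_separable X0, X0 x0 &
      forall v x (e d : R), X0 v -> y + G v != 0 -> X0 x -> unit_ball x ->
        0 < e -> 0 < d ->
        exists2 c, conv_hull (rotated_witnesses G (y + G v) e `&` X0) c & rnorm (x - c) < d].
Proof.
have [D [cD Dx0 sD Dproj DW]] := ex_determining_set y x0.
have DcD : D `<=` closure D by exact: subset_closure.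
exists (closure D); split => //.
- by exists D; split.
- exact: DcD.
move=> v x e d /closure_rnormP hv z0 /closure_rnormP hx Bx e0 d0.
set z := y + G v in z0 *.
have nz : 0 < rnorm z.
  by rewrite lt0r rnorm_ge0 andbT; apply: contra_neq z0; exact: rnorm_eq0.
have [C C0 hC] := continuous_rnorm_bound hG.
(* One third of [e] each goes to the change of [G u + z], to the change of [rnorm z], and later to
   [n.+1%:R^-1]. The bound [rnorm z / 2] keeps [y + G b] nonzero. *)
pose h := Num.min (e / 3) (rnorm z / 2).
have h0 : 0 < h by rewrite lt_min !divr_gt0.
have he : h <= e / 3 by rewrite ge_min lexx.
have hz : h <= rnorm z / 2 by rewrite ge_min lexx orbT.
have [b Db hb] := hv (h / C) (divr_gt0 h0 C0).
have Gb : rnorm (G v - G b) < h.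
  by rewrite -linearB; apply: le_lt_trans (hC _) _; rewrite mulrC -ltr_pdivlMr.
have [a' Da' ha'] := hx (d / 4) (ltac:(lra)).
pose a := ball_proj a'; have Da : D a by exact: Dproj.
have ha : rnorm (x - a) < d / 2.
  by have := rnorm_sub_ball_proj a' Bx; rewrite -/a; lra.
have zz : rnorm (z - (y + G b)) < h.
  by rewrite /z opprD addrACA subrr add0r.
have zb0 : y + G b != 0.
  apply: contraTneq zz => ->; rewrite subr0 -leNgt; lra.
pose m := Num.min (e / 3) (d / 2).
have m0 : 0 < m by rewrite lt_min !divr_gt0.
have me : m <= e / 3 by rewrite ge_min lexx.
have md : m <= d / 2 by rewrite ge_min lexx orbT.
have [n hn] := ex_invS_lt m0.
have [c hc ac] := DW a b n Da Db (ball_projP a') zb0.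
move: hn hc ac; set r := _^-1 => hn hc ac.
exists c.
  apply: conv_hullS hc => s [[w w1 [u [Bu hu] <-]] Ds]; split; last exact: DcD.
  exists w => //; exists u => //; split => //.
  have := rnormD (G u + z) (- (z - (y + G b))).
  rewrite rnormN opprB -(addrA (G u)) (addrC z) subrK.
  have := rnorm_sub z (y + G b); lra.
have := rnormD (x - a) (a - c); rewrite addrA subrK; lra.
Qed.

End DeterminingSubspace.

(** * Targets from the SCD property, and the norm equality for targets *)

Section Targets.
Context {R : realType} {k : scalar_kind}.
Local Notation K := (scalar_field R k).

Lemma conv_hull_image (X Z : normedModType K) (T : {linear X -> Z}) (A : set X) :
  conv_hull (T @` A) `<=` T @` conv_hull A.
Proof.
apply: conv_hull_min => [_ [x Ax <-]|t _ _ t0 t1 [x hx <-] [y hy <-]].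
  by exists x => //; exact: sub_conv_hull.
exists (of_real t *: x + of_real (1 - t) *: y); first exact: conv_hull_convex.
by rewrite linearD !linearZ.
Qed.

(** The complement of an open half-space is convex, so if it held all of [W] it would hold the
    hull. *)
Lemma slice_conv_hull (X Z : normedModType K) (T : {linear X -> Z}) (W : set X)
    (f : {linear Z -> K^o}) (b : R) c :
  conv_hull W c -> b < re_part (f (T c) : K) -> exists2 s, W s & b < re_part (f (T s) : K).
Proof.
move=> hc hb; apply: contrapT => hno; move: hb; apply/negP; rewrite -leNgt.
move: c hc; apply: conv_hull_min => [s Ws|t x y t0 t1 /= hx hy].
  by rewrite /= leNgt; apply/negP => h; apply: hno; exists s.
rewrite !linearD !linearZ /= raddfD /= !re_partM.
have : t * re_part (f (T x) : K) <= t * b by exact: ler_wpM2l.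
have : (1 - t) * re_part (f (T y) : K) <= (1 - t) * b by apply: ler_wpM2l => //; lra.
lra.
Qed.

Context {X Y : normedModType K} (G : {linear X -> Y}).

(** Take [T x] with functional value within [al / 2] of the supremum. A point of the hull close
    enough to [x] still has a value above the slice level, and then so does one of the rotated
    witnesses generating the hull. Undoing its rotation stays in the subspace [X0]. *)
Lemma slice_witness (Z : normedModType K) (T : {linear X -> Z}) (X0 : set X) (S : set Z)
    (z : Y) (e : R) :
    continuous T -> is_closed_subspace X0 -> is_slice (T @` (X0 `&` @unit_ball R k X)) S ->
    (forall x (d : R), X0 x -> unit_ball x -> 0 < d ->
       exists2 c, conv_hull (rotated_witnesses G z e `&` X0) c & rnorm (x - c) < d) ->
  exists w u, [/\ `|w : K| = 1, X0 u, unit_ball u, S (T (w *: u)) &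
    1 + rnorm z - e < rnorm (G u + z)].
Proof.
move=> cT [_ X00 _ X0Z] [f [al [cf al0 ->]]] hX0; set A := T @` _.
have [C C0 hC] := continuous_rnorm_bound cT.
have [C' C'0 hC'] := continuous_rnorm_bound cf.
have hfT x : re_part (f (T x) : K) <= C' * C * rnorm x.
  apply: (le_trans (re_part_le_norm _)); apply: (le_trans (hC' _)).
  by rewrite -mulrA ler_wpM2l // ltW.
have CC : 0 < C' * C by rewrite mulr_gt0.
have hs : has_sup [set re_part (f a : K) | a in A].
  split.
    exists (re_part (f (T 0) : K)), (T 0) => //; exists 0 => //.
    by split => //; exact: unit_ball0.
  exists (C' * C) => _ [_ [x [_ Bx] <-] <-]; apply: (le_trans (hfT x)).
  by rewrite ler_piMr // ltW.
have [|_ [_ [x [X0x Bx] <-] <-] hx] := @sup_adherent _ _ (al / 2) _ hs; first lra.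
have d0 : 0 < al / 2 / (C' * C) by rewrite divr_gt0 //; lra.
have [c hc xc] := hX0 x _ X0x Bx d0.
have [|s [Ws X0s] hs'] := slice_conv_hull hc (T := T) (f := f)
    (b := sup [set re_part (f a : K) | a in A] - al).
  move: xc; rewrite ltr_pdivlMr // mulrC => xc.
  have := hfT (x - c); rewrite !linearB raddfB /=; lra.
have Bs := rotated_witnesses_ball Ws.
have [w w1 [u [Bu hu] su]] := Ws.
have w0 : w != 0 by rewrite -normr_eq0 w1 oner_eq0.
exists w, u; split => //.
- have -> : u = w^-1 *: s by rewrite -su scalerA mulVf // scale1r.
  exact: X0Z.
- by rewrite su; split => //; exists s.
Qed.

Hypotheses (hG : continuous G) (hADP : alternative_Daugavet G).

(* The normed sums control every convex combination: if [v n] is the sum of the first [n]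
   of the [u i] and [x] is a convex combination of them, then [v n - x] has norm at most [n - 1]. *)
Lemma conv_hull_range_norm (y : Y) (u v : nat -> X) (e : R) :
    v 0%N = 0 -> (forall n, v n.+1 = v n + u n) -> (forall n, unit_ball (u n)) ->
    (forall n, n.+1%:R - e < rnorm (y + G (v n))) ->
  conv_hull (range u) `<=` [set x | unit_ball x /\ 2 - e < rnorm (G x + y)].
Proof.
move=> v0 vS Bu hv.
have hvn n : rnorm (v n) <= n%:R.
  elim: n => [|n IH]; first by rewrite v0 rnorm0.
  rewrite vS -natr1; apply: (le_trans (rnormD _ _)); exact: lerD (Bu n).
have H : conv_hull (range u) `<=`
    [set x | unit_ball x /\ exists N, forall n, (N <= n)%N -> rnorm (v n - x) <= n%:R - 1].
  apply: conv_hull_min => [_ [i _ <-]|t x x' t0 t1 [Bx [N hN]] [Bx' [N' hN']]].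
    (* Once [n > i], removing the summand [u i] from [v n] leaves [n - 1] vectors of the ball. *)
    split => //; exists i.+1; elim=> // n IH; rewrite leq_eqVlt => /orP[/eqP[<-]|/IH h].
      by rewrite vS addrK -natr1 addrK.
    rewrite vS addrAC -natr1; apply: (le_trans (rnormD _ _)).
    by have := Bu n; rewrite /unit_ball /=; lra.
  split; first exact: unit_ball_convex.
  exists (maxn N N') => n; rewrite geq_max => /andP[/hN h /hN' h'].
  have -> : v n - (of_real t *: x + of_real (1 - t) *: x') =
      of_real t *: (v n - x) + of_real (1 - t) *: (v n - x').
    rewrite !scalerBr addrACA -scalerDl -of_realD opprD; congr (_ + _).
    by rewrite addrC subrK of_real1 scale1r.
  apply: (le_trans (rnormD _ _)); rewrite !rnormZr !ger0_norm ?subr_ge0 //.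
  have := ler_wpM2l t0 h; have := ler_wpM2l (ltac:(lra) : 0 <= 1 - t) h'; lra.
move=> x /H [Bx [N hN]]; split => //.
(* The vector [y + G (v N)] has norm above [N + 1 - e], and removing [G (v N - x)] costs at most
   [N - 1], which leaves more than [2 - e]. *)
have := rnormD (G x + y) (G (v N - x)).
have -> : G x + y + G (v N - x) = y + G (v N).
  by rewrite linearB addrC addrA subrK addrC.
have := rnorm_le_ball hG hADP; have := hN N (leqnn N).
have := hv N; rewrite -natr1.
have GB : rnorm (G (v N - x)) <= rnorm (v N - x).
  by have := rnorm_le_opnormM (v N - x) hG; rewrite alternative_Daugavet_opnorm // mul1r.
by move: GB; lra.
Qed.

Lemma SCD_target (Z : normedModType K) (T : {linear X -> Z}) :
  continuous T -> SCD_on_separable_subspaces T -> is_target G T.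
Proof.
move=> cT hSCD; split; first exact: alternative_Daugavet_opnorm.
move=> x0 e y Bx0 e0 y1.
have [X0 [sX0 sepX0 X0x0 hX0]] := ex_determining_subspace hG hADP y x0.
have [_ [S [slS SCD]]] := hSCD X0 sX0 sepX0.
(* Capping at 1 makes [n.+1%:R - e1] nonnegative, so the vectors [y + G v] below are nonzero. *)
pose e1 := Num.min e 1.
have e10 : 0 < e1 by rewrite lt_min e0 ltr01.
have e1e : e1 <= e by rewrite ge_min lexx.
have e11 : e1 <= 1 by rewrite ge_min lexx orbT.
have step (nv : nat * X) : exists wu : K * X,
    X0 nv.2 -> nv.1.+1%:R - e1 < rnorm (y + G nv.2) ->
    [/\ `|wu.1| = 1, X0 wu.2, unit_ball wu.2, S nv.1 (T (wu.1 *: wu.2)) &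
      nv.1.+2%:R - e1 < rnorm (y + G (nv.2 + wu.2))].
  case: nv => n v /=.
  have [[X0v hv]|h] := pselect (X0 v /\ n.+1%:R - e1 < rnorm (y + G v)); last first.
    by exists (0, 0) => X0v hv; exfalso; exact: h.
  have z0 : y + G v != 0.
    apply: contraTneq hv => ->; rewrite rnorm0 -leNgt subr_ge0 (le_trans e11) //.
    by rewrite ler1n.
  (* The tolerance is the whole excess of the current norm over [n.+1%:R - e1]; the next norm then
     exceeds [n.+2%:R - e1], and no error accumulates. *)
  have d0 : 0 < rnorm (y + G v) - (n.+1%:R - e1) by rewrite subr_gt0.
  have [|w [u [w1 X0u Bu Su hu]]] :=
    slice_witness (z := y + G v) cT sX0 (slS n) (e := rnorm (y + G v) - (n.+1%:R - e1)).
    by move=> x d X0x Bx d'0; exact: hX0.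
  exists (w, u) => _ _; split => //=.
  rewrite linearD addrA addrC; move: hu; rewrite -(natr1 n.+1); lra.
have [F hF] := choice step.
pose v := fix v n := if n is n'.+1 then v n' + (F (n', v n')).2 else 0.
pose w n := (F (n, v n)).1; pose u n := (F (n, v n)).2.
have vP n : X0 (v n) /\ n.+1%:R - e1 < rnorm (y + G (v n)).
  have [_ X00 X0D _] := sX0.
  elim: n => [|n [X0v hv]] /=.
    by split => //; rewrite linear0 addr0 y1; lra.
  by have [_ X0u _ _ h] := hF (n, v n) X0v hv; split => //; exact: X0D.
have FP n := hF (n, v n) (vP n).1 (vP n).2.
exists (range u); split.
- by move=> _ [n _ <-]; have [_ _] := FP n.
- have Bu n : unit_ball (u n) by have [_ _] := FP n.
  have hcv := conv_hull_range_norm (v := v) (u := u) (e := e1)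
    erefl (fun=> erefl) Bu (fun n => (vP n).2).
  by move=> x /hcv[Bx hx]; split => //; lra.
- have meets n : range (fun n => T (w n *: u n)) `&` S n !=set0.
    by exists (T (w n *: u n)); split; [exists n|have [_ _ _] := FP n].
  have /closure_rnormP/(_ e e0)[c hc hTc] :
      closure (conv_hull (range (fun n => T (w n *: u n)))) (T x0).
    by apply: SCD => //; exists x0.
  (* The rotations [w n] demanded by the slices are absorbed by [aconv], so [F] can consist of the
     unrotated [u n]. *)
  have sub : range (fun n => T (w n *: u n)) `<=`
      T @` [set a *: x | a in @unit_scalars R k & x in range u].
    move=> _ [n _ <-]; exists (w n *: u n) => //; exists (w n); first by have [] := FP n.
    by exists (u n) => //; exists n.
  have Tc := conv_hull_image (conv_hullS sub hc).
  apply: (@le_lt_trans _ _ (rnorm (T x0 - c))%:E); last by rewrite lte_fin.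
  by apply: ereal_inf_lbound; exists c.
Qed.

(** For [t <= 1], adding [1 - t] times [y] reaches [g + y]; for [t > 1], adding [t - 1] times [g]
    reaches [t] times [g + y]. *)
Lemma rnorm_add_scale_ge (g y : Y) (t d : R) : rnorm g <= 1 -> rnorm y = 1 -> 0 <= t ->
  0 <= d -> 2 - d < rnorm (g + y) -> 1 + t - (1 + t) * d <= rnorm (g + of_real t *: y).
Proof.
move=> g1 y1 t0 d0 h; have [t1|t1] := leP t 1.
  have := rnormD (g + of_real t *: y) (of_real (1 - t) *: y).
  rewrite rnormZr y1 mulr1 ger0_norm ?subr_ge0 //.
  rewrite -addrA -scalerDl -of_realD subrKC of_real1 scale1r.
  have : 0 <= t * d by exact: mulr_ge0.
  lra.
have t10 : 0 <= t - 1 by lra.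
have := rnormD (g + of_real t *: y) (of_real (t - 1) *: g).
rewrite rnormZr ger0_norm //.
have -> : g + of_real t *: y + of_real (t - 1) *: g = of_real t *: (g + y).
  by rewrite scalerDr addrAC of_realB of_real1 scalerBl scale1r subrKC.
rewrite rnormZr ger0_norm //.
have := ler_wpM2l t10 g1; have := ler_wpM2l t0 (ltW h); lra.
Qed.

Lemma target_sup_opnorm (T : {linear X -> Y}) : continuous T -> is_target G T ->
  sup [set opnorm (G \+ w \*: T) | w in unit_scalars] = 1 + opnorm T.
Proof.
move=> cT [G1 hT]; set M := sup _; set N := opnorm T.
have hub : has_ubound [set opnorm (G \+ w \*: T) | w in @unit_scalars R k].
  by exists (1 + N) => _ [w w1 <-]; apply: opnorm_le => x Bx; exact: opnorm_add_scale.
have hM (w : K) x : `|w| = 1 -> unit_ball x -> rnorm (G x + w *: T x) <= M.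
  move=> w1 Bx; apply: le_trans (ub_le_sup hub _); last by exists w.
  apply: (rnorm_le_opnorm (T := G \+ w \*: T) (C := 1 + N)) Bx => x' Bx'.
  exact: opnorm_add_scale.
have [C C0 hC] := continuous_rnorm_bound cT.
have hCB := rnorm_bound_ball (ltW C0) hC.
apply/eqP; rewrite eq_le; apply/andP; split.
  apply: ge_sup; first by exists (opnorm (G \+ 1 \*: T)), 1 => //; exact: unit_scalar1.
  by move=> _ [w w1 <-]; apply: opnorm_le => x Bx; exact: opnorm_add_scale.
(* If [T] vanishes there is no direction to normalize, and the bound comes from [opnorm G = 1]. *)
have [N0|N0] := leP N 0.
  have T0 x : T x = 0.
    apply: rnorm_eq0; apply/eqP; rewrite eq_le rnorm_ge0 andbT.
    by rewrite (le_trans (rnorm_le_opnormM x cT)) // mulr_le0_ge0 // rnorm_ge0.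
  apply: (@le_trans _ _ (opnorm G)); first by rewrite G1; lra.
  apply: opnorm_le => x Bx; have := hM 1 x (normr1 _) Bx.
  by rewrite T0 scaler0 addr0.
apply/ler_addgt0Pr => e e0.
have N3 : 0 < 3 + N by lra.
(* The bound [N / 2] makes [T x0] nonzero. The total loss is at most [(3 + N) * d]: one [d] from the
   choice of [x0], one from the distance of [T x0] to [T c], and [(1 + N) * d] from
   [rnorm_add_scale_ge]. *)
pose d := Num.min (N / 2) (e / (3 + N)).
have d0 : 0 < d by rewrite lt_min !divr_gt0.
have dN : d <= N / 2 by rewrite ge_min lexx.
have de : d * (3 + N) <= e by rewrite -ler_pdivlMr // ge_min lexx orbT.
have [|x0 Bx0 hx0] := opnorm_adherent (T := T) d0; first by exists C.
set t := rnorm (T x0) in hx0; rewrite -/N in hx0.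
have t0 : 0 < t by lra.
have tN : t <= N := rnorm_le_opnorm (T := T) hCB Bx0.
pose y := of_real t^-1 *: T x0.
have y1 : rnorm y = 1.
  by rewrite /y rnormZr ger0_norm ?invr_ge0 ?(ltW t0) // mulVf // gt_eqF.
have Ty : T x0 = of_real t *: y.
  by rewrite /y scalerA -of_realM divff ?gt_eqF // of_real1 scale1r.
have [F [FB hF /ereal_inf_lt[_ [_ [c hc <-] <-]]]] := hT x0 d y Bx0 d0 y1.
rewrite lte_fin => hcd.
(* The point [x] follows [c] with the rotations dropped. At a generator the bound is [hM], and
   convexity of the norm carries it to the hull. *)
have [x hx hxc] : exists2 x, conv_hull F x & rnorm (G x + T c) <= M.
  move: c hc {hcd}; apply: conv_hull_min.
    move=> _ [w w1 [x Fx <-]].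
    by exists x; [exact: sub_conv_hull|rewrite linearZ; apply: hM => //; exact: FB].
  move=> s c c' s0 s1 [x hx hxc] [x' hx' hxc'].
  exists (of_real s *: x + of_real (1 - s) *: x'); first exact: conv_hull_convex.
  have -> : G (of_real s *: x + of_real (1 - s) *: x') +
      T (of_real s *: c + of_real (1 - s) *: c') =
      of_real s *: (G x + T c) + of_real (1 - s) *: (G x' + T c').
    by rewrite !linearD !linearZ /= addrACA.
  apply: (le_trans (rnormD _ _)); rewrite !rnormZr !ger0_norm ?subr_ge0 //.
  have := ler_wpM2l s0 hxc; have := ler_wpM2l (ltac:(lra) : 0 <= 1 - s) hxc'; lra.
have [Bx hGx] := hF x hx.
have h1 : rnorm (G x) <= 1 by exact: rnorm_le_ball.
have := rnorm_add_scale_ge h1 y1 (ltW t0) (ltW d0) hGx; rewrite -Ty.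
have := rnormD (G x + T c) (T x0 - T c).
rewrite addrA -(addrA (G x)) (addrC (T c)) addrA addrK => h2.
have := ler_wpM2r (ltW d0) tN; lra.
Qed.

End Targets.

Theorem proposition3p19 (R : realType) (k : scalar_kind)
    (X Y : completeNormedModType (scalar_field R k)) (G : {linear X -> Y})
    (hG : continuous G) (hADP : alternative_Daugavet G) :
  (forall (Z : completeNormedModType (scalar_field R k)) (T : {linear X -> Z}),
     continuous T -> SCD_on_separable_subspaces T -> is_target G T) /\
  (forall T : {linear X -> Y},
     continuous T -> SCD_on_separable_subspaces T ->
     sup [set opnorm (G \+ w \*: T) | w in unit_scalars] = 1 + opnorm T).
Proof.
split=> [Z T cT hT|T cT hT]; first exact: SCD_target.
by apply: target_sup_opnorm => //; exact: SCD_target.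
Qed.
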